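(* Let $r > 1$ and $k > 1$ be integers such that $r < W(r,k)$ and $k < W(r,k)$, and let $n \geq 1$ be the exponent of the leading power of $r$ in the base-$r$ expansion of $W(r,k)$. If $k \geq \sqrt{n+1}$, then $$W(r,k) < r^{n+1} \leq r^{k^{2}}.$$
   Context: For positive integers $r, k$, the van der Waerden number $W(r,k)$ is the least positive integer $N$ such that every coloring of the integer interval $[1,N]=\{1,\dots,N\}$ with $r$ colors contains a monochromatic arithmetic progression of $k$ terms. For $W(r,k) > r > 1$, write the base-$r$ expansion $W(r,k) = b_{n}r^{n} + b_{n-1}r^{n-1} + \cdots + b_{0}$ with integers $1 \leq b_n \leq r-1$ and $0 \leq b_i \leq r-1$ for $i<n$; the exponent of the leading power is this $n$, equivalently the unique integer with $r^{n} \leq W(r,k) < r^{n+1}$. *)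

(* Defs.v *)
From mathcomp Require Import all_boot all_order all_algebra.
From mathcomp Require Import boolp classical_sets reals.

Set Implicit Arguments.
Unset Strict Implicit.
Unset Printing Implicit Defensive.

Definition monochromatic_ap (r k N : nat) (c : nat -> 'I_r) : Prop :=
  exists (a d : nat) (j : 'I_r), (0 < d)%N /\
    forall i : nat, (i < k)%N -> (1 <= a + i * d <= N)%N /\ c (a + i * d)%N = j.

(* Colorings of [1,N] are represented by colorings of nat; monochromatic_ap
   only looks at the values on [1,N]. *)
Definition van_der_Waerden_property (r k N : nat) : Prop :=
  forall c : nat -> 'I_r, monochromatic_ap k N c.

Definition is_van_der_Waerden_number (r k N : nat) : Prop :=
  [/\ (0 < N)%N, van_der_Waerden_property r k N &
      forall M : nat, (0 < M)%N -> van_der_Waerden_property r k M -> (N <= M)%N].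

(* The default value 0 would be taken only if no such N existed; by van der
   Waerden's theorem this never happens for positive r and k. *)
Definition W (r k : nat) : nat :=
  xget 0%N [set N | is_van_der_Waerden_number r k N]%classic.

Definition base_expansion (r m n : nat) (b : nat -> nat) : Prop :=
  [/\ m = (\sum_(i < n.+1) b i * r ^ i)%N,
      (1 <= b n <= r - 1)%N &
      forall i : nat, (i < n)%N -> (0 <= b i <= r - 1)%N].

Definition is_leading_exponent (r m n : nat) : Prop :=
  exists b : nat -> nat, base_expansion r m n b.

(* Main.v *)
Require Import Defs.
From mathcomp Require Import all_boot all_order all_algebra.
From mathcomp Require Import reals.

Import GRing.Theory Num.Theory.

(** A number with [n + 1] digits in base [r] is below [r ^ (n + 1)]
    ([leading_exponent_upper_bound]). Since [r > 1], the second inequality compares exponents, and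
    [n + 1 <= k ^ 2] is the square-root hypothesis squared ([sqrt_natr_le_natr]). *)

Lemma sum_digits_lt_expn (r m : nat) (b : nat -> nat) :
  (forall i, (i < m)%N -> (b i < r)%N) ->
  (\sum_(i < m) b i * r ^ i < r ^ m)%N.
Proof.
elim: m => [|m IHm] b_lt_r; first by rewrite big_ord0 expn0.
rewrite big_ord_recr /= expnS.
(* The lower digits give less than [r ^ m], so the total stays below [(b m + 1) * r ^ m], and
   [b m + 1 <= r]. *)
apply: (@leq_trans (r ^ m + b m * r ^ m)).
  by rewrite ltn_add2r IHm // => i /ltnW; exact: b_lt_r.
by rewrite -mulSn leq_mul2r b_lt_r ?orbT.
Qed.

Lemma leading_exponent_upper_bound (r m n : nat) :
  (0 < r)%N -> is_leading_exponent r m n -> (m < r ^ n.+1)%N.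
Proof.
move=> r_gt0 [b [-> /andP[_ bn_le] b_le]].
(* Writing [r] as [(r - 1).+1] turns the goal into the form [b i <= r - 1] of the digit bounds; the
   leading digit [i = n] has its own bound. *)
apply: sum_digits_lt_expn => i; rewrite -(subnK r_gt0) addn1 !ltnS.
by rewrite leq_eqVlt => /predU1P[-> // | /b_le/andP[]].
Qed.

Lemma sqrt_natr_le_natr (R : rcfType) (m k : nat) :
  (Num.sqrt (m%:R : R) <= k%:R)%R = (m <= k ^ 2)%N.
Proof.
rewrite -(ler_nat R) natrX -[RHS]ler_sqrt ?exprn_ge0 ?ler0n //.
by rewrite sqrtr_sqr ger0_norm ?ler0n.
Qed.

Theorem theorem2p2 (R : realType) (r k n : nat)
  (hr : (1 < r)%N) (hk : (1 < k)%N)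
  (hrW : (r < W r k)%N) (hkW : (k < W r k)%N)
  (hn1 : (1 <= n)%N) (hn : is_leading_exponent r (W r k) n)
  (hkn : (Num.sqrt ((n + 1)%:R : R) <= k%:R)%R) :
  (W r k < r ^ (n + 1) <= r ^ (k ^ 2))%N.
Proof.
rewrite leq_exp2l // -(sqrt_natr_le_natr R) hkn andbT addn1.
exact: leading_exponent_upper_bound (ltnW hr) hn.
Qed.
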